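(* Let $K\subsetneq L$ be a field extension and let $G=L^\times/K^\times$, with quotient map $\pi:L^\times\to L^\times/K^\times$. Define $\mathcal{I}$ to be the collection of all projectively independent subsets of $L^\times/K^\times$. Then $\mathcal{I}$ is an independence structure on $G$. With this structure, $G$ is a modular abelian independence group. Now define, for each $A\subseteq G$, $$V_A=\operatorname{span}_K\{x\in L^\times:\pi(x)\in A\}\subseteq L.$$ Then $$\operatorname{cl}(A)=\mathbb{P}_K(V_A)\qquad\text{and}\qquad \rho(A)=\dim_K V_A.$$ Consequently, the flats of $G$ are precisely the sets $\mathbb{P}_K(W)$, where $W$ ranges over the $K$-subspaces of $L$.
   Context: A finitary matroid is a pair $(E,\mathcal{I})$ consisting of a set $E$ and a nonempty collection $\mathcal{I}$ of subsets of $E$ (called the independent sets) such that: (I1) if $A\in\mathcal{I}$ and $B\subseteq A$ then $B\in\mathcal{I}$; (I2) if $A,B$ are finite elements of $\mathcal{I}$ with $|B|=|A|+1$, then there is $x\in B\setminus A$ with $\{x\}\cup A\in\mathcal{I}$; (I3) if $A\subseteq E$ and every finite subset of $A$ belongs to $\mathcal{I}$, then $A\in\mathcal{I}$. The collection $\mathcal{I}$ is called an independence structure on $E$. A basis of a subset $A\subseteq E$ is an inclusion-maximal independent subset of $A$; any two bases of $A$ have the same cardinality, and the rank $\rho(A)$ is that cardinal number. An element $x\in E$ depends on $A\subseteq E$ if either $x\in A$, or $x\notin A$ and $\{x\}\cup B\notin\mathcal{I}$ for some independent $B\subseteq A$. The closure is $\operatorname{cl}(A)=\{x\in E: x\text{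 depends on }A\}$, and $A$ is a flat if $\operatorname{cl}(A)=A$. The finitary matroid is modular if $\rho(A)+\rho(B)=\rho(A\cup B)+\rho(A\cap B)$ (as cardinals) for all flats $A,B$. An independence group is a group $G$ (written multiplicatively) together with an independence structure $\mathcal{I}$ on the set $G$ such that for every $g\in G$ and $A\subseteq G$ one has $gA\in\mathcal{I}$ if and only if $A\in\mathcal{I}$, where $gA=\{gx:x\in A\}$. A modular abelian independence group is an independence group that is modular as a finitary matroid and whose group is abelian. For a field extension $K\subseteq L$ with quotient map $\pi:L^\times\to L^\times/K^\times$: a subset $A$ of $L^\times/K^\times$ is projectively independent if for one (and hence every) choice of representatives $x_a\in a$ (one for each $a\in A$), the set $\{x_a:a\in A\}$ is linearly independent over $K$. For a $K$-subspace $W$ of $L$, $\mathbb{P}_K(W)=\pi(W\setminus\{0\})$. *)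

(* Defs.v *)
From HB Require Import structures.
From mathcomp Require Import all_boot all_order all_algebra.
From mathcomp Require Import boolp classical_sets functions cardinality.
Set Implicit Arguments.
Unset Strict Implicit.
Unset Printing Implicit Defensive.
Import GRing.Theory.

Local Open Scope classical_set_scope.
Local Open Scope card_scope.
Local Open Scope quotient_scope.
Local Open Scope ring_scope.

(** Finitary matroids *)

Record independence_structure (E : Type) (I : set (set E)) : Prop := {
  indep_nonempty : I !=set0;
  indep_sub : forall A B, I A -> B `<=` A -> I B;
  indep_exchange : forall (n : nat) A B, A #= `I_n -> B #= `I_n.+1 ->
    I A -> I B -> exists2 x, (B `\` A) x & I (x |` A);
  indep_finitary : forall A,
    (forall B, finite_set B -> B `<=` A -> I B) -> I A
}.

Definition matroid_basis (E : Type) (I : set (set E)) (A : set E) :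
    set (set E) :=
  [set B | [/\ I B, B `<=` A &
               forall C, I C -> C `<=` A -> B `<=` C -> C = B]].

(* A cardinal number is represented by a set of that cardinality, so that
   equality of cardinals is [#=].  The rank of A is represented by a basis of
   A chosen once and for all (any two bases of A are equipotent); in an
   independence structure a basis always exists, see
   [matroid_basis_matroid_rank]. *)
Definition matroid_rank (E : Type) (I : set (set E)) (A : set E) : set E :=
  xget set0 (matroid_basis I A).

Lemma finite_sub_chain (E : Type) (F : set (set E)) (B : set E) :
  F !=set0 -> total_on F subset -> finite_set B ->
  B `<=` \bigcup_(X in F) X -> exists2 X, F X & B `<=` X.
Proof.
elim/Peq: E F B => E F B.
move=> [X0 FX0] totF /finite_seqP[s ->]; elim: s => [|x s IHs] sF.
  by exists X0.
have [|X FX sX] := IHs; first by move=> y ys; apply: sF; rewrite /= inE ys orbT.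
have [|Y FY Yx] := sF x; first by rewrite /= inE eqxx.
have [XY|YX] := totF _ _ FX FY.
- by exists Y => // y /=; rewrite inE => /predU1P[->//|/sX/XY].
- by exists X => // y /=; rewrite inE => /predU1P[->|/sX//]; apply: YX.
Qed.

Lemma matroid_basis_matroid_rank (E : Type) (I : set (set E)) (A : set E) :
  independence_structure I -> matroid_basis I A (matroid_rank I A).
Proof.
move=> [[A0 IA0] sub _ fin].
suff [B [[IB BA] maxB]] : exists B, (I B /\ B `<=` A) /\
    forall C, B `<` C -> ~ (I C /\ C `<=` A).
  apply: (xgetPex set0); exists B; split => // C IC CA BC.
  apply: contrapT => CB; apply: (maxB C) => //; split => // CsB.
  by apply: CB; apply/seteqP.
apply: (@Zorn_bigcup E [set B | I B /\ B `<=` A]) => F FP totF.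
split; last by move=> x [X /FP[_ XA] /XA].
apply: fin => B finB BF; have [F0|/set0P[X FX]] := eqVneq F set0.
  by apply: (sub A0) => // x /BF[X]; rewrite F0.
have [|Y FY BY] := finite_sub_chain _ totF finB BF; first by exists X.
by apply: (sub Y) => //; have [] := FP _ FY.
Qed.

(* The sum of two cardinals, represented by the disjoint union. *)
Definition card_sum (S T : Type) (A : set S) (B : set T) : set (S + T) :=
  (inl @` A) `|` (inr @` B).

Definition depends (E : Type) (I : set (set E)) (A : set E) (x : E) : Prop :=
  A x \/ (~ A x /\ exists B, [/\ I B, B `<=` A & ~ I (x |` B)]).

Definition matroid_closure (E : Type) (I : set (set E)) (A : set E) : set E :=
  [set x | depends I A x].

Definition flat (E : Type) (I : set (set E)) (A : set E) : Prop :=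
  matroid_closure I A = A.

Definition modular (E : Type) (I : set (set E)) : Prop :=
  forall A B, flat I A -> flat I B ->
    card_sum (matroid_rank I A) (matroid_rank I B) #=
    card_sum (matroid_rank I (A `|` B)) (matroid_rank I (A `&` B)).

Record independence_group (G : groupType) (I : set (set G)) : Prop := {
  indgroup_indep : independence_structure I;
  indgroup_translate : forall (g : G) (A : set G),
    I [set (g * x)%g | x in A] <-> I A
}.

Record modular_abelian_independence_group (G : groupType) (I : set (set G)) :
    Prop := {
  maig_indgroup : independence_group I;
  maig_modular : modular I;
  maig_abelian : forall x y : G, (x * y = y * x)%g
}.

(** The multiplicative group of a field *)

Section MultiplicativeGroup.
Variable L : fieldType.

Definition mulgroup : Type := {x : L | x != 0}.
HB.instance Definition _ := Choice.on mulgroup.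

Implicit Types x y : mulgroup.

Definition mulgroup_one : mulgroup := exist _ 1 (oner_neq0 L).

Fact mulgroup_inv_subproof x : (val x)^-1 != 0.
Proof. by rewrite invr_neq0 // (valP x). Qed.
Definition mulgroup_inv x : mulgroup :=
  exist _ (val x)^-1 (mulgroup_inv_subproof x).

Fact mulgroup_mul_subproof x y : val x * val y != 0.
Proof. by rewrite mulf_neq0 // ?(valP x) ?(valP y). Qed.
Definition mulgroup_mul x y : mulgroup :=
  exist _ (val x * val y) (mulgroup_mul_subproof x y).

Fact mulgroup_mulA : associative mulgroup_mul.
Proof. by move=> x y z; apply: val_inj; apply: mulrA. Qed.
Fact mulgroup_mul1 : left_id mulgroup_one mulgroup_mul.
Proof. by move=> x; apply: val_inj; apply: mul1r. Qed.
Fact mulgroup_mulr1 : right_id mulgroup_one mulgroup_mul.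
Proof. by move=> x; apply: val_inj; apply: mulr1. Qed.
Fact mulgroup_mulV : left_inverse mulgroup_one mulgroup_inv mulgroup_mul.
Proof. by move=> x; apply: val_inj; apply: mulVf (valP x). Qed.
Fact mulgroup_mulrV : right_inverse mulgroup_one mulgroup_inv mulgroup_mul.
Proof. by move=> x; apply: val_inj; apply: mulfV (valP x). Qed.

HB.instance Definition _ := isGroup.Build mulgroup
  mulgroup_mulA mulgroup_mul1 mulgroup_mulr1 mulgroup_mulV mulgroup_mulrV.

End MultiplicativeGroup.

(* The field extension is given by the (necessarily injective) ring
   morphism iota : K -> L. *)
Section FieldExtension.
Variables (K L : fieldType) (iota : {rmorphism K -> L}).

(** The quotient group L^* / K^* *)

Implicit Types (x y z : mulgroup L).

Definition same_class x y : bool :=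
  `[< exists2 k : K, k != 0 & val x = iota k * val y >].

Fact same_class_refl : reflexive same_class.
Proof.
by move=> x; apply/asboolP; exists 1; rewrite ?oner_neq0 // rmorph1 mul1r.
Qed.

Fact same_class_sym : symmetric same_class.
Proof.
suff H x y : same_class x y -> same_class y x.
  by move=> x y; apply/idP/idP; apply: H.
move=> /asboolP[k k0 xE]; apply/asboolP; exists k^-1.
  by rewrite invr_neq0.
by rewrite xE fmorphV mulKf // fmorph_eq0.
Qed.

Fact same_class_trans : transitive same_class.
Proof.
move=> y x z /asboolP[k k0 xE] /asboolP[l l0 yE]; apply/asboolP.
by exists (k * l); rewrite ?mulf_neq0 // xE yE rmorphM mulrA.
Qed.

Canonical same_class_equiv :=
  EquivRel same_class same_class_refl same_class_sym same_class_trans.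

Definition projgroup : Type := {eq_quot same_class}.
HB.instance Definition _ : EqQuotient _ same_class projgroup :=
  EqQuotient.on projgroup.
HB.instance Definition _ := Choice.on projgroup.

Definition proj x : projgroup := \pi_projgroup x.

Lemma eq_proj x y :
  proj x = proj y <-> exists2 k : K, k != 0 & val x = iota k * val y.
Proof.
split=> [/eqmodP/asboolP //|H].
by apply/eqmodP/asboolP.
Qed.

Lemma proj_repr (a : projgroup) : proj (repr a) = a.
Proof. exact: reprK. Qed.

Definition projgroup_mul (a b : projgroup) : projgroup :=
  proj (repr a * repr b)%g.
Definition projgroup_inv (a : projgroup) : projgroup := proj (repr a)^-1%g.

Lemma projgroup_mulE x y : projgroup_mul (proj x) (proj y) = proj (x * y)%g.
Proof.
have /eq_proj[k k0 xE] := proj_repr (proj x).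
have /eq_proj[l l0 yE] := proj_repr (proj y).
apply/eq_proj; exists (k * l); first by rewrite mulf_neq0.
by rewrite [LHS]/= xE yE rmorphM /= mulrACA.
Qed.

Lemma projgroup_invE x : projgroup_inv (proj x) = proj x^-1%g.
Proof.
have /eq_proj[k k0 xE] := proj_repr (proj x).
apply/eq_proj; exists k^-1; first by rewrite invr_neq0.
by rewrite [LHS]/= xE invfM fmorphV.
Qed.

Fact projgroup_mulA : associative projgroup_mul.
Proof.
move=> a b c; rewrite -(proj_repr a) -(proj_repr b) -(proj_repr c).
by rewrite !projgroup_mulE mulgA.
Qed.
Fact projgroup_mul1 : left_id (proj 1%g) projgroup_mul.
Proof. by move=> a; rewrite -(proj_repr a) projgroup_mulE mul1g. Qed.
Fact projgroup_mulr1 : right_id (proj 1%g) projgroup_mul.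
Proof. by move=> a; rewrite -(proj_repr a) projgroup_mulE mulg1. Qed.
Fact projgroup_mulV : left_inverse (proj 1%g) projgroup_inv projgroup_mul.
Proof.
by move=> a; rewrite -(proj_repr a) projgroup_invE projgroup_mulE mulVg.
Qed.
Fact projgroup_mulrV : right_inverse (proj 1%g) projgroup_inv projgroup_mul.
Proof.
by move=> a; rewrite -(proj_repr a) projgroup_invE projgroup_mulE mulgV.
Qed.

HB.instance Definition _ := isGroup.Build projgroup
  projgroup_mulA projgroup_mul1 projgroup_mulr1 projgroup_mulV projgroup_mulrV.

Lemma projM x y : proj (x * y)%g = (proj x * proj y)%g.
Proof. by rewrite -projgroup_mulE. Qed.

(** Linear algebra in the (possibly infinite-dimensional) K-space L *)

Definition lin_comb (s : seq L) (c : L -> K) : L :=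
  \sum_(v <- s) iota (c v) * v.

Definition lin_indep (X : set L) : Prop :=
  forall (s : seq L) (c : L -> K), uniq s -> [set` s] `<=` X ->
    lin_comb s c = 0 -> forall v, v \in s -> c v = 0.

Definition lin_span (X : set L) : set L :=
  [set w | exists (s : seq L) (c : L -> K),
             [set` s] `<=` X /\ w = lin_comb s c].

Record subspace (W : set L) : Prop := {
  subspace0 : W 0;
  subspaceD : forall v w, W v -> W w -> W (v + w);
  subspaceZ : forall (k : K) v, W v -> W (iota k * v)
}.

Definition lin_basis (W : set L) : set (set L) :=
  [set X | lin_indep X /\ lin_span X = W].

(* As for [matroid_rank], the cardinal dim_K W is represented by a chosen
   K-basis of W, see [lin_basis_lin_dim]. *)
Definition lin_dim (W : set L) : set L := xget set0 (lin_basis W).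

Lemma lin_basis_lin_dim (W : set L) : subspace W -> lin_basis W (lin_dim W).
Proof.
move=> [W0 WD WZ]; apply: (xgetPex set0).
have [|X [[XI XW] maxX]] := @Zorn_bigcup L [set X | lin_indep X /\ X `<=` W].
  move=> F FP totF; split; last by move=> x [X /FP[_ XW] /XW].
  move=> s c us sF s0 v vs; have [X0 FX0 _] := sF v vs.
  have [||Y FY sY] := finite_sub_chain _ totF _ sF.
  - by exists X0.
  - exact: finite_seq.
  - by have [/(_ s c us sY s0 v vs)] := FP _ FY.
exists X; split => //; apply/seteqP; split=> [w [s [c [sX ->]]]|w Ww].
  rewrite /lin_comb; elim: s sX => [|x s IHs] sX; first by rewrite big_nil.
  rewrite big_cons; apply: WD.
    by apply/WZ/XW/sX; rewrite /= inE eqxx.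
  by apply: IHs => y ys; apply: sX; rewrite /= inE ys orbT.
apply: contrapT => Xw; apply: (maxX (w |` X)).
  split=> [x Xx|]; first by right.
  move=> /(_ w (or_introl erefl)) wX; apply: Xw.
  exists [:: w], (fun=> 1); split; first by move=> x /=; rewrite inE => /eqP ->.
  by rewrite /lin_comb big_seq1 rmorph1 mul1r.
split; last by move=> x [->|/XW].
move=> s c us sX s0.
have sX' v : v \in s -> v != w -> X v by move=> /sX[->|//]; rewrite eqxx.
have remX : [set` rem w s] `<=` X.
  by move=> v /=; rewrite mem_rem_uniq // inE => /andP[vw vs]; apply: sX'.
have cw : w \in s -> c w = 0.
  move=> ws; apply: contrapT => /eqP cw0; apply: Xw.
  exists (rem w s), (fun v => - (c w)^-1 * c v); split => //.
  move: s0; rewrite /lin_comb (perm_big _ (perm_to_rem ws)) big_cons /=.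
  move=> /eqP; rewrite addrC addr_eq0 => /eqP sE.
  under eq_bigr do rewrite rmorphM -mulrA.
  by rewrite -mulr_sumr sE rmorphN fmorphV mulrNN mulKf // fmorph_eq0.
have r0 : lin_comb (rem w s) c = 0.
  have [ws|ws] := boolP (w \in s); last by rewrite rem_id.
  move: s0; rewrite /lin_comb (perm_big _ (perm_to_rem ws)) big_cons /=.
  by rewrite cw // rmorph0 mul0r add0r.
move=> v vs; have [vw|vw] := eqVneq v w; first by rewrite vw cw // -vw.
apply: (XI _ _ (rem_uniq w us) remX r0).
by rewrite mem_rem_uniq // inE vw.
Qed.

(** Projective independence *)

(* By [proj_indep_every] the choice of representatives is immaterial. *)
Definition proj_indep (A : set projgroup) : Prop :=
  exists2 r : projgroup -> mulgroup L,
    (forall a, A a -> proj (r a) = a) & lin_indep [set val (r a) | a in A].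

Lemma proj_indep_every (A : set projgroup) (r : projgroup -> mulgroup L) :
  proj_indep A -> (forall a, A a -> proj (r a) = a) ->
  lin_indep [set val (r a) | a in A].
Proof.
move=> [r0 r0A r0I] rA s c us sA s0.
pose cls (v : L) := proj (insubd (1%g : mulgroup L) v).
have clsE x : cls (val x) = proj x by rewrite /cls valKd.
pose f v := val (r0 (cls v)); pose g v := val (r (cls v)).
have /choice[k kP] u : exists k : K,
    g u = iota k * u \/ ~ exists2 a, A a & u = val (r0 a).
  have [[a Aa ->]|nu] := pselect (exists2 a, A a & u = val (r0 a)); last first.
    by exists 0; right.
  have /eq_proj[k _ rE] : proj (r a) = proj (r0 a) by rewrite rA ?r0A.
  by exists k; left; rewrite /g clsE r0A.
have fP v : v \in s -> [/\ g (f v) = v, v = iota (k (f v)) * f v & f v != 0].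
  move=> /sA[a Aa <-].
  have fE : f (val (r a)) = val (r0 a) by rewrite /f clsE rA.
  have gE : g (val (r0 a)) = val (r a) by rewrite /g clsE r0A.
  rewrite fE gE; split => //; last exact: valP (r0 a).
  by have [<-|[]] := kP (val (r0 a)); [rewrite gE|exists a].
have finj : {in s &, injective f}.
  by move=> v w /fP[vE _ _] /fP[wE _ _] vw; rewrite -vE -wE vw.
move=> v vs; have [gfv vE fv0] := fP v vs.
have := r0I (map f s) (fun u => c (g u) * k u).
rewrite (map_inj_in_uniq finj) => /(_ us).
have fsA : [set` map f s] `<=` [set val (r0 a) | a in A].
  move=> _ /= /mapP[w /sA[a Aa <-] ->].
  by exists a => //; rewrite /f clsE rA.
move=> /(_ fsA); rewrite /lin_comb big_map.
have -> : \sum_(w <- s) iota (c (g (f w)) * k (f w)) * f w = lin_comb s c.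
  apply: eq_big_seq => w /fP[gE wE _].
  by rewrite gE rmorphM -mulrA -wE.
move=> /(_ s0 (f v) (map_f f vs)); rewrite gfv => /eqP.
rewrite mulf_eq0 => /orP[/eqP //|/eqP kv0].
have /sA[a _ va] := vs; have := valP (r a); rewrite /= va vE kv0.
by rewrite rmorph0 mul0r eqxx.
Qed.

Definition PK (W : set L) : set projgroup :=
  proj @` [set x | W (val x)].

Definition VA (A : set projgroup) : set L :=
  lin_span (val @` [set x | A (proj x)]).

End FieldExtension.

Arguments proj_indep {K L} iota A.
Arguments PK {K L} iota W.
Arguments VA {K L} iota A.

(* Main.v *)
Require Import Defs.
From mathcomp Require Import all_boot all_order all_algebra.
From mathcomp Require Import boolp classical_sets functions cardinality.
Local Open Scope classical_set_scope.
Local Open Scope card_scope.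
Import GRing.Theory.

(** Choosing one nonzero representative in each class of [L^*/K^*] identifies
    the group with a subset of [L] in such a way that projective independence
    becomes [K]-linear independence ([proj_indepE]) and [V_A] becomes the span
    of the image of [A] ([VAE]).  All the claims are then linear algebra in the space
    [L], whose dimension may be infinite.

    Closure: a point outside [A] depends on [A] exactly when its
    representative lies in [V_A], because a basis of [A] is sent to a linear
    basis of [V_A] ([matroid_rank_basis]).  As a subspace is determined by its
    nonzero vectors, [VA (PK W) = W], and this turns the description of the
    closure into the description of the flats.

    Cardinalities: the only substantial fact is that an independent set has at
    most the cardinality of a set that spans it, finite or not ([steinitz]).
    The proof runs Steinitz exchange transfinitely, by Zorn's lemma on the
    partial exchanges that preserve independence, and so uses no cardinal
    arithmetic.  It gives the exchange axiom, the equipotence of linear bases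
    and the equality of rank and dimension.

    Modularity: for subspaces [W] and [W'], take bases [X] of [W] and [Y] of
    [W'] that both extend a basis of [W `&` W'].  Then [X `&` Y] is a basis of
    [W `&` W'] and [X `|` Y] one of [W + W'], and the cardinal identity is
    the set-theoretic one for [X] and [Y] ([card_sum_setUI]). *)

(** * Cardinals of sets and of disjoint sums *)

Section Cardinals.
Set Implicit Arguments.
Unset Strict Implicit.

(** Relations spare the choice of a default value in the target type, which
    may be empty, and need not be functional, which suits the partial
    exchanges of [steinitz]. *)
Lemma card_le_relP (T U : Type) (A : set T) (B : set U) :
  A #<= B <-> exists R : T -> U -> Prop,
    (forall x, A x -> exists2 y, B y & R x y) /\
    (forall x x' y, R x y -> R x' y -> x = x').
Proof.
split=> [/card_leP[f]|[R [RAB Rinj]]].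
  exists (fun x y => exists2 a : A, val a = x & val (f a) = y); split.
    move=> x Ax; pose a : A := SigSub (mem_set Ax).
    by exists (val (f a)); [apply: set_mem (valP (f a))|exists a].
  move=> _ _ y [a <- <-] [b <- /val_inj fab].
  by congr (val _); apply: 'inj_f; rewrite ?inE.
have [->|/set0P[x0 Ax0]] := eqVneq A set0; first exact: card_ge0.
have [y0 _ _] := RAB _ Ax0.
have /choice[f fP] x : exists y, A x -> B y /\ R x y.
  have [/RAB[y By Rxy]|nAx] := pselect (A x); first by exists y.
  by exists y0.
have finj : {in A &, injective f}.
  move=> x x' /set_mem /fP[_ Rx] /set_mem /fP[_ Rx'] fxx'.
  by apply: Rinj Rx _; rewrite fxx'.
rewrite -(card_le_eql (inj_card_eq finj)).
by apply: subset_card_le => _ [x /fP[Bfx _] <-].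
Qed.

Lemma card_sum_le (S S' T T' : Type) (A : set S) (A' : set S')
    (B : set T) (B' : set T') :
  A #<= A' -> B #<= B' -> Defs.card_sum A B #<= Defs.card_sum A' B'.
Proof.
move=> /card_le_relP[R [RA Ri]] /card_le_relP[Q [QB Qi]]; apply/card_le_relP.
exists (fun u v => match u, v with
  | inl x, inl y => R x y | inr x, inr y => Q x y | _, _ => False end).
split=> [_ [[x /RA[y A'y Rxy] <-]|[x /QB[y B'y Qxy] <-]]|].
- by exists (inl y) => //; left; exists y.
- by exists (inr y) => //; right; exists y.
- by move=> [x|x] [x'|x'] [y|y] // => [/Ri Rx /Rx ->|/Qi Qx /Qx ->].
Qed.

Lemma card_sum_eq (S S' T T' : Type) (A : set S) (A' : set S')
    (B : set T) (B' : set T') :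
  A #= A' -> B #= B' -> Defs.card_sum A B #= Defs.card_sum A' B'.
Proof.
by move=> /card_eqPle[? ?] /card_eqPle[? ?]; apply/card_eqPle; split;
  apply: card_sum_le.
Qed.

Lemma card_sum_setUI (T : Type) (X Y : set T) :
  Defs.card_sum X Y #= Defs.card_sum (X `|` Y) (X `&` Y).
Proof.
(* [f] moves the elements of [Y] that are not already in [X] to the left. *)
pose f (u : T + T) : T + T := match u with
  | inl x => inl x
  | inr y => if `[<X y>] then inr y else inl y end.
have finj : {in Defs.card_sum X Y &, injective f}.
  move=> u v /set_mem + /set_mem.
  move=> [[x Xx <-]|[x Yx <-]] [[y Xy <-]|[y Yy <-]] //=.
  - by case: asboolP => // nXy [xy]; case: nXy; rewrite -xy.
  - by case: asboolP => // nXx [xy]; case: nXx; rewrite xy.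
  - by case: asboolP => _; case: asboolP => _ // -[->].
rewrite card_eq_sym.
suff <- : f @` Defs.card_sum X Y = Defs.card_sum (X `|` Y) (X `&` Y).
  exact: inj_card_eq.
apply/seteqP; split=> [_ [_ [[x Xx <-]|[y Yy <-]] <-]|].
- by left; exists x => //; left.
- rewrite /=; case: asboolP => Xy; first by right; exists y.
  by left; exists y => //; right.
move=> _ [[x XYx <-]|[x [Xx Yx] <-]].
- have [Xx|nXx] := pselect (X x).
    by exists (inl x) => //; left; exists x.
  exists (inr x); first by right; exists x => //; case: XYx.
  by rewrite /=; case: asboolP.
- by exists (inr x); [right; exists x|rewrite /=; case: asboolP].
Qed.

End Cardinals.

(** * Linear independence and bases in a space of any dimension *)

Section LinearAlgebra.
Local Open Scope ring_scope.
Set Implicit Arguments.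
Unset Strict Implicit.
Variables (K L : fieldType) (iota : {rmorphism K -> L}).

Local Notation subspace := (subspace iota).
Local Notation lin_comb := (lin_comb iota).
Local Notation lin_span := (lin_span iota).
Local Notation lin_indep := (lin_indep iota).
Local Notation lin_basis := (lin_basis iota).
Implicit Types (s t : seq L) (c d : L -> K) (v w : L) (W X Y Z : set L).

(** The list of a linear combination may have repetitions; counting
    multiplicities rewrites it over any duplicate-free list containing it, so
    that two combinations can be brought to a common support. *)
Lemma lin_comb_widen s u c : uniq u -> {subset s <= u} ->
  lin_comb s c = lin_comb u (fun v => c v *+ count_mem v s).
Proof.
move=> uu; elim: s => [|x s IHs] su.
  rewrite /Defs.lin_comb big_nil big1 // => v _.
  by rewrite /= mulr0n rmorph0 mul0r.
rewrite /Defs.lin_comb big_cons -/(lin_comb s c).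
have /IHs -> : {subset s <= u} by move=> v vs; rewrite su // inE vs orbT.
under [RHS]eq_bigr => v do rewrite /= mulrnDr rmorphD mulrDl.
rewrite big_split /= (bigD1_seq x) ?su ?inE ?eqxx //= mulr1n big1 ?addr0 //.
by move=> v /negPf; rewrite eq_sym => ->; rewrite mulr0n rmorph0 mul0r.
Qed.

Lemma lin_spanE X w : lin_span X w <->
  exists s c, [/\ uniq s, [set` s] `<=` X & w = lin_comb s c].
Proof.
split=> [[s [c [sX ->]]]|[s [c [_ sX ->]]]]; last by exists s, c.
exists (undup s); eexists; split; first exact: undup_uniq.
  by move=> v /=; rewrite mem_undup => /sX.
by apply: lin_comb_widen; [exact: undup_uniq|move=> v; rewrite mem_undup].
Qed.

Lemma subspace_lin_span X : subspace (lin_span X).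
Proof.
split.
- by exists [::], (fun=> 0); split => //; rewrite /Defs.lin_comb big_nil.
- move=> _ _ [s [c [sX ->]]] [t [d [tX ->]]].
  pose u := undup (s ++ t); have uu : uniq u := undup_uniq _.
  rewrite (@lin_comb_widen s u) //; last first.
    by move=> v vs; rewrite mem_undup mem_cat vs.
  rewrite (@lin_comb_widen t u) //; last first.
    by move=> v vt; rewrite mem_undup mem_cat vt orbT.
  exists u, (fun v => c v *+ count_mem v s + d v *+ count_mem v t); split.
    by move=> v /=; rewrite mem_undup mem_cat => /orP[/sX|/tX].
  rewrite /Defs.lin_comb -big_split; apply: eq_bigr => v _ /=.
  by rewrite rmorphD mulrDl.
- move=> k _ [s [c [sX ->]]]; exists s, (fun v => k * c v); split => //.
  rewrite /Defs.lin_comb mulr_sumr; apply: eq_bigr => v _.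
  by rewrite rmorphM mulrA.
Qed.

Lemma sub_lin_span X : X `<=` lin_span X.
Proof.
move=> v Xv; exists [:: v], (fun=> 1); split.
  by move=> x /=; rewrite inE => /eqP ->.
by rewrite /Defs.lin_comb big_seq1 rmorph1 mul1r.
Qed.

Lemma lin_span_min X W : subspace W -> X `<=` W -> lin_span X `<=` W.
Proof.
move=> [W0 WD WZ] XW _ [s [c [sX ->]]]; rewrite /Defs.lin_comb big_seq.
by elim/big_ind: _ => // v /sX/XW; apply: WZ.
Qed.

Lemma lin_spanS X Y : X `<=` Y -> lin_span X `<=` lin_span Y.
Proof.
move=> XY; apply: lin_span_min; first exact: subspace_lin_span.
by move=> v /XY; apply: sub_lin_span.
Qed.

Lemma lin_span1 w v : lin_span [set w] v -> exists k, v = iota k * w.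
Proof.
apply: (@lin_span_min _ [set v | exists k, v = iota k * w]).
  split=> [|_ _ [k ->] [l ->]|k _ [l ->]].
  - by exists 0; rewrite rmorph0 mul0r.
  - by exists (k + l); rewrite rmorphD mulrDl.
  - by exists (k * l); rewrite rmorphM mulrA.
by move=> _ ->; exists 1; rewrite rmorph1 mul1r.
Qed.

Lemma subspaceI W W' : subspace W -> subspace W' -> subspace (W `&` W').
Proof.
move=> [W0 WD WZ] [W'0 W'D W'Z].
by split=> [|v w [? ?] [? ?]|k v [? ?]]; split; auto.
Qed.

Lemma lin_indepS X Y : X `<=` Y -> lin_indep Y -> lin_indep X.
Proof. by move=> XY YI s c us sX; apply: YI => // v /sX/XY. Qed.

Lemma lin_indep0 : lin_indep set0.
Proof. by move=> s c _ s0 _ v /s0. Qed.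

Lemma lin_indep_neq0 X v : lin_indep X -> X v -> v != 0.
Proof.
move=> XI Xv; apply/eqP => v0.
have := XI [:: v] (fun=> 1) isT; rewrite /Defs.lin_comb big_seq1 v0 mulr0.
move=> /(_ _ erefl 0); rewrite inE eqxx => h.
suff /eqP : (1 : K) = 0 by rewrite oner_eq0.
by apply: h => // x /=; rewrite inE => /eqP ->; rewrite -v0.
Qed.

Lemma lin_indep1 w : w != 0 -> lin_indep [set w].
Proof.
move=> w0 s c us sw + v vs.
rewrite (@lin_comb_widen s [:: w]) //; last first.
  by move=> x /sw /= ->; rewrite inE.
have <- : v = w := sw _ vs.
rewrite /Defs.lin_comb big_seq1 count_uniq_mem // vs mulr1n => /eqP.
by rewrite mulf_eq0 fmorph_eq0 (sw _ vs) (negPf w0) orbF => /eqP.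
Qed.

(** Subtracting the two expressions of [w] gives a linear relation between
    distinct elements of [Z], since [X] and [Y] are disjoint. *)
Lemma lin_span_disjoint Z X Y w : lin_indep Z -> X `<=` Z -> Y `<=` Z ->
  (forall v, X v -> ~ Y v) -> lin_span X w -> lin_span Y w -> w = 0.
Proof.
move=> ZI XZ YZ XY /lin_spanE[s [c [us sX ->]]] /lin_spanE[t [d [ut tY wE]]].
have st v : v \in t -> v \notin s.
  by move=> /tY; apply: contraPN => /sX/XY.
rewrite /Defs.lin_comb big1_seq // => v /andP[_ vs].
suff -> : c v = 0 by rewrite rmorph0 mul0r.
have := ZI (s ++ t) (fun x => if x \in s then c x else - d x) _ _ _ v.
rewrite vs; apply.
- rewrite cat_uniq us ut andbT; apply/hasPn => x /st //.
- by move=> x /=; rewrite mem_cat => /orP[/sX/XZ|/tY/YZ].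
- transitivity (lin_comb s c + lin_comb t (fun v => - d v)).
    rewrite /Defs.lin_comb big_cat; congr (_ + _); apply: eq_big_seq => x.
      by move=> ->.
    by move=> /st/negPf ->.
  rewrite wE /Defs.lin_comb -big_split big1 // => x _ /=.
  by rewrite rmorphN mulNr subrr.
- by rewrite mem_cat vs.
Qed.

(** A linear relation splits into a part on [X] and a part on the rest of [Y];
    their values are opposite, so each of them vanishes. *)
Lemma lin_indepU X Y : lin_indep X -> lin_indep Y ->
  (forall w, lin_span X w -> lin_span (Y `\` X) w -> w = 0) ->
  lin_indep (X `|` Y).
Proof.
move=> XI YI XY s c us sXY s0.
pose s1 := [seq v <- s | `[< X v >]]; pose s2 := [seq v <- s | ~~ `[< X v >]].
have s1X : [set` s1] `<=` X.
  by move=> v /=; rewrite mem_filter => /andP[/asboolP].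
have s2Y : [set` s2] `<=` Y `\` X.
  move=> v /=; rewrite mem_filter => /andP[/asboolP nXv /sXY].
  by move=> [].
have sE : lin_comb s1 c + lin_comb s2 c = 0.
  by rewrite -s0 /Defs.lin_comb !big_filter [RHS](bigID (fun v => `[< X v >])).
have s10 : lin_comb s1 c = 0.
  apply: XY; first by exists s1, c.
  have -> : lin_comb s1 c = iota (-1) * lin_comb s2 c.
    by apply/eqP; rewrite rmorphN1 mulN1r -addr_eq0 sE.
  by apply: (subspaceZ (subspace_lin_span _)); exists s2, c.
have s20 : lin_comb s2 c = 0 by move: sE; rewrite s10 add0r.
move=> v vs; have [Xv|nXv] := pselect (X v).
- apply: (XI _ _ (filter_uniq _ us) s1X s10).
  by rewrite mem_filter vs andbT; apply/asboolP.
- apply: (YI _ _ (filter_uniq _ us) _ s20) => [x /s2Y[]//|].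
  by rewrite mem_filter vs andbT; apply/asboolP.
Qed.

Lemma lin_indepU1 X w :
  lin_indep X -> ~ lin_span X w -> lin_indep (w |` X).
Proof.
move=> XI Xw; have [_ _ XZ] := subspace_lin_span X.
have [X0 _ _] := subspace_lin_span X.
rewrite setUC; apply: lin_indepU => //.
  by apply: lin_indep1; apply/eqP => w0; apply: Xw; rewrite w0.
move=> v Xv /(lin_spanS (@subDsetl _ _ _))/lin_span1[k vE].
have [k0|k0] := eqVneq k 0; first by rewrite vE k0 rmorph0 mul0r.
case: Xw; have -> : w = iota k^-1 * v by rewrite vE fmorphV mulKf // fmorph_eq0.
exact: XZ.
Qed.

Lemma lin_indepU1N X w : lin_indep (w |` X) -> ~ X w -> ~ lin_span X w.
Proof.
move=> wXI nXw Xw; have /eqP := lin_indep_neq0 wXI (or_introl erefl); apply.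
apply: (lin_span_disjoint wXI (X := X) (Y := [set w])) => //.
- by move=> v Xv vw; apply: nXw; rewrite -vw.
- exact: sub_lin_span.
Qed.

(** A linear relation involves finitely many vectors, hence a single member
    of the chain.  Both applications of Zorn's lemma below rest on this. *)
Lemma lin_indepU_bigcup (T : Type) (F : set T) (f : T -> set L) X :
  F !=set0 -> total_on F (fun i j => f i `<=` f j) ->
  (forall i, F i -> lin_indep (X `|` f i)) ->
  lin_indep (X `|` \bigcup_(i in F) f i).
Proof.
move=> [i0 Fi0] totF XfI s c us sXF.
have [||||_ [i Fi <-] sfi] :=
    @finite_sub_chain _ (f @` F) ([set` s] `\` X).
- by exists (f i0); exists i0.
- by move=> _ _ [i Fi <-] [j Fj <-]; apply: totF.
- exact: finite_setD.
- by move=> v [/sXF[//|[i Fi fiv]] _]; exists (f i) => //; exists i.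
apply: (XfI i Fi) => // v vs.
by have [Xv|nXv] := pselect (X v); [left|right; apply: sfi].
Qed.

Lemma lin_basis_extend W X : subspace W -> lin_indep X -> X `<=` W ->
  exists2 Y, lin_basis W Y & X `<=` Y.
Proof.
move=> subW XI XW.
have [F FP totF|Z [[XZI ZW] maxZ]] :=
    @Zorn_bigcup L [set Z | lin_indep (X `|` Z) /\ Z `<=` W].
  split; last by move=> v [Z /FP[_ ZW] /ZW].
  have [->|/set0P F0] := eqVneq F set0; first by rewrite bigcup_set0 setU0.
  by apply: lin_indepU_bigcup => // Z /FP[].
exists (X `|` Z); last by move=> v ?; left.
split => //; apply/seteqP; split=> [|w Ww].
  by apply: lin_span_min => // v [/XW|/ZW].
apply: contrapT => nw; apply: (maxZ (w |` Z)).
  split; first by move=> v ?; right.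
  by move=> /(_ w (or_introl erefl)) Zw; apply/nw/sub_lin_span; right.
split; last by move=> v [->|/ZW].
by rewrite setUCA; apply: lin_indepU1.
Qed.

(** Start from [X] and replace its elements one at a time by elements of [Y],
    keeping independence.  A partial exchange is recorded as the relation [F]
    between replaced elements and their substitutes, and [rest F] is the
    resulting set.  If some [x] of [X] is not replaced, then [rest F] without
    [x] does not span [x], so some [y] of [Y] is outside its span and can
    replace [x]; hence a maximal exchange replaces all of [X]. *)
Lemma steinitz X Y : lin_indep X -> X `<=` lin_span Y -> X #<= Y.
Proof.
move=> XI XY.
pose rest (F : set (L * L)) := (X `\` (fst @` F)) `|` (snd @` F).
(* The third condition says that a substitute belongs to [X] only if it has
   itself been replaced: [rest F] then counts every vector once. *)
pose P (F : set (L * L)) := [/\ snd @` F `<=` Y,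
  forall x x' y, F (x, y) -> F (x', y) -> x = x',
  (snd @` F) `&` X `<=` fst @` F & lin_indep (rest F)].
have [C CP totC|F [[FY Finj FX FI] maxF]] := @Zorn_bigcup _ P.
  split.
  - move=> _ [p [F CF Fp] <-]; have [FY _ _ _] := CP _ CF.
    by apply: FY; exists p.
  - move=> x x' y [F CF Fx] [F' CF' F'x'].
    have [_ Finj _ _] := CP _ CF; have [_ F'inj _ _] := CP _ CF'.
    have [FF'|F'F] := totC _ _ CF CF'.
    + exact: (F'inj _ _ y (FF' _ Fx)).
    + exact: (Finj _ _ y _ (F'F _ F'x')).
  - move=> y [[p [F CF Fp] <-] Xp]; have [_ _ FX _] := CP _ CF.
    have [|q Fq <-] := FX p.2; first by split => //; exists p.
    by exists q => //; exists F.
  - have [->|/set0P C0] := eqVneq C set0.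
      by rewrite /rest bigcup_set0 !image_set0 setU0 setD0.
    rewrite /rest [snd @` _]image_bigcup; apply: lin_indepU_bigcup => //.
      move=> F F' CF CF'.
      by have [FF'|F'F] := totC _ _ CF CF'; [left|right]; apply: image_subset.
    move=> F CF; have [_ _ _] := CP _ CF; apply: lin_indepS.
    move=> v [[Xv nv]|Fv]; [left; split => // -[p Fp pv]|by right].
    by apply: nv; exists p => //; exists F.
apply/card_le_relP; exists (fun x y => F (x, y)); split => // x Xx.
suff [[x' y] /= Fxy <-] : (fst @` F) x.
  by exists y => //; apply: FY; exists (x', y).
apply: contrapT => nFx.
(* [Z] is [rest F] without [x]. *)
pose Z := (X `\` (x |` fst @` F)) `|` (snd @` F).
have ZI : lin_indep (x |` Z).
  apply: lin_indepS FI => v [->|[[Xv nv]|Fv]]; [by left| |by right].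
  by left; split => // Fv; apply: nv; right.
have nZx : ~ Z x.
  by move=> [[_ []]|Fx]; [left|apply/nFx/FX].
have nspan := lin_indepU1N ZI nZx.
have [y Yy nZy] : exists2 y, Y y & ~ lin_span Z y.
  apply: contrapT => noy; apply: nspan.
  apply: (lin_span_min (subspace_lin_span Z) _ (XY x Xx)) => y Yy.
  by apply: contrapT => nZy; apply: noy; exists y.
have nFy : ~ (snd @` F) y.
  by move=> Fy; apply/nZy/sub_lin_span; right.
apply: (maxF ((x, y) |` F)).
  split; first by move=> p ?; right.
  by move=> /(_ (x, y) (or_introl erefl)) Fxy; apply: nFx; exists (x, y).
split.
- by move=> _ [p [->|Fp] <-] //; apply: FY; exists p.
- move=> a b z [[-> zy]|Fa] [[-> zy']|Fb] //.
  + by case: nFy; exists (b, z).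
  + by case: nFy; exists (a, z).
  + exact: Finj Fa Fb.
- move=> _ [[p [->|Fp] <-] /= Xp].
  + apply: contrapT => nd; apply/nZy/sub_lin_span; left.
    split => // -[yx|[q Fq qy]].
      by apply: nd; exists (x, y) => //; left.
    by apply: nd; exists q => //; right.
  + by have [|q Fq <-] := FX p.2; [split => //; exists p|exists q => //; right].
- have yZI : lin_indep (y |` Z).
    by apply: lin_indepU1 nZy; apply: lin_indepS ZI => v Zv; right.
  apply: lin_indepS yZI => v [[Xv nv]|[p [->|Fp] <-]];
    [right; left|by left|by right; right; exists p].
  split => // -[vx|[p Fp pv]]; apply: nv.
    by exists (x, y) => //; left.
  by exists p => //; right.
Qed.

Lemma lin_basis_card W X Y : lin_basis W X -> lin_basis W Y -> X #= Y.
Proof.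
move=> [XI XW] [YI YW].
apply: Cantor_Bernstein; apply: steinitz => // v.
- by rewrite YW -XW; apply: sub_lin_span.
- by rewrite XW -YW; apply: sub_lin_span.
Qed.

End LinearAlgebra.

(** * The matroid of projectively independent sets *)

Section ProjectiveMatroid.
Local Open Scope ring_scope.
Set Implicit Arguments.
Unset Strict Implicit.
Variables (K L : fieldType) (iota : {rmorphism K -> L}).

Local Notation G := (projgroup iota).
Local Notation proj := (proj iota).
Local Notation I := (proj_indep iota).
Local Notation lin_span := (lin_span iota).
Local Notation lin_indep := (lin_indep iota).
Local Notation lin_basis := (lin_basis iota).
Local Notation subspace := (subspace iota).
Local Notation VA := (VA iota).
Local Notation PK := (PK iota).
Implicit Types (A B : set G) (a b g : G) (W : set L).

Definition rep (a : G) : L := val (repr a).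

Lemma rep_inj : injective rep.
Proof. by move=> a b /val_inj ab; rewrite -(proj_repr a) ab proj_repr. Qed.

Lemma rep_card A : rep @` A #= A.
Proof. by apply: inj_card_eq => a b _ _; apply: rep_inj. Qed.

Lemma rep_proj (x : mulgroup L) :
  exists2 k, k != 0 & val x = iota k * rep (proj x).
Proof. by apply/(eq_proj iota); rewrite proj_repr. Qed.

Lemma proj_indepE A : I A <-> lin_indep (rep @` A).
Proof.
split=> [IA|AI]; last by exists repr => // a _; apply: proj_repr.
by apply: proj_indep_every IA _ => a _; apply: proj_repr.
Qed.

Lemma subspace_VA A : subspace (VA A).
Proof. exact: subspace_lin_span. Qed.

Lemma VAE A : VA A = lin_span (rep @` A).
Proof.
have sub := subspace_lin_span iota; have subA := subspace_VA A.
apply/seteqP; split; apply: lin_span_min => //.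
- move=> _ [x Ax <-]; have [k _ ->] := rep_proj x.
  by apply: subspaceZ => //; apply: sub_lin_span; exists (proj x).
- move=> _ [a Aa <-]; apply: sub_lin_span; exists (repr a) => //=.
  by rewrite proj_repr.
Qed.

Lemma PKE W a : subspace W -> PK W a <-> W (rep a).
Proof.
move=> subW; split=> [[x Wx <-]|Wa]; last first.
  by exists (repr a) => //; apply: proj_repr.
have [k k0 xE] := rep_proj x.
have -> : rep (proj x) = iota k^-1 * val x.
  by rewrite xE fmorphV mulKf // fmorph_eq0.
exact: subspaceZ.
Qed.

(** A subspace is spanned by its nonzero vectors. *)
Lemma VA_PK W : subspace W -> VA (PK W) = W.
Proof.
move=> subW; rewrite VAE; apply/seteqP; split.
  by apply: lin_span_min => // _ [a /(PKE _ subW) Wa <-].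
move=> w Ww; have [->|w0] := eqVneq w 0.
  by apply: subspace0; apply: subspace_lin_span.
pose x : mulgroup L := exist _ w w0.
have [k _ xE] := rep_proj x.
rewrite -[w]/(val x) xE; apply: subspaceZ; first exact: subspace_lin_span.
by apply: sub_lin_span; exists (proj x) => //; exists x.
Qed.

Lemma PKI W W' : subspace W -> subspace W' -> PK (W `&` W') = PK W `&` PK W'.
Proof.
move=> sW sW'; have sWW' := subspaceI sW sW'.
apply/seteqP; split=> a.
  by move=> /(PKE _ sWW')[Wa W'a]; split; apply/PKE.
by move=> [/(PKE _ sW) Wa /(PKE _ sW') W'a]; apply/PKE.
Qed.

Lemma proj_indepU1 A a : I A -> ~ VA A (rep a) -> I (a |` A).
Proof.
move=> /proj_indepE AI nAa; apply/proj_indepE.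
by rewrite image_setU image_set1; apply: lin_indepU1; rewrite -?VAE.
Qed.

Lemma proj_indepU1N A a : I (a |` A) -> ~ A a -> ~ VA A (rep a).
Proof.
move=> /proj_indepE; rewrite image_setU image_set1 VAE => aAI nAa.
by apply: lin_indepU1N => // -[b Ab /rep_inj ba]; apply: nAa; rewrite -ba.
Qed.

Lemma sub_VA A a : A a -> VA A (rep a).
Proof. by move=> Aa; rewrite VAE; apply: sub_lin_span; exists a. Qed.

Lemma VAS A B : A `<=` B -> VA A `<=` VA B.
Proof. by move=> AB; rewrite !VAE; apply/lin_spanS/image_subset. Qed.

Lemma proj_indep_structure : independence_structure I.
Proof.
split.
- by exists set0; apply/proj_indepE; rewrite image_set0; apply: lin_indep0.
- move=> A B /proj_indepE AI BA; apply/proj_indepE.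
  by apply: lin_indepS AI; apply: image_subset.
- move=> n A B An Bn IA IB; apply: contrapT => noex.
  suff : `I_n.+1 #<= `I_n by rewrite card_le_II ltnn.
  rewrite -(card_le_eql Bn) -(card_le_eqr An).
  rewrite -(card_le_eql (rep_card B)) -(card_le_eqr (rep_card A)).
  apply: (@steinitz _ _ iota); first exact/proj_indepE.
  move=> _ [x Bx <-]; rewrite -VAE; apply: contrapT => nAx; apply: noex.
  exists x; last exact: proj_indepU1.
  by split => // Ax; apply/nAx/sub_VA.
- move=> A finA; apply/proj_indepE => s c us sA.
  have fs : finite_set [set a | A a /\ rep a \in s].
    apply: (@sub_finite_set _ _ (rep @^-1` [set` s])) => [a []//|].
    by apply: finite_preimage => // a b _ _; apply: rep_inj.
  have /proj_indepE := finA _ fs (fun a => @proj1 _ _); apply => // v vs.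
  by have [a Aa av] := sA v vs; exists a => //; split => //; rewrite av.
Qed.

(** A basis of [A] is maximal among the independent subsets of [A], so each
    point of [A] has its representative in the span of that basis. *)
Lemma matroid_rank_basis A : lin_basis (VA A) (rep @` matroid_rank I A).
Proof.
have [IR RA maxR] := matroid_basis_matroid_rank A proj_indep_structure.
split; first exact/proj_indepE.
rewrite -VAE; apply/seteqP; split; first exact: VAS.
rewrite [X in X `<=` _]VAE; apply: lin_span_min; first exact: subspace_VA.
move=> _ [a Aa <-]; apply: contrapT => nRa.
apply: (nRa); apply: sub_VA; rewrite -(maxR (a |` matroid_rank I A)).
- by left.
- exact: proj_indepU1.
- by move=> b [->|/RA].
- by move=> b; right.
Qed.

Lemma matroid_rank_card A X : lin_basis (VA A) X -> matroid_rank I A #= X.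
Proof.
move=> XA; rewrite -(card_eql (rep_card _)).
exact: lin_basis_card (matroid_rank_basis A) XA.
Qed.

(** When the representative of [a] lies in [V_A] and [a] is not in [A], the
    independent subset witnessing the dependence is a basis of [A]. *)
Lemma closure_PK A : matroid_closure I A = PK (VA A).
Proof.
have subA := subspace_VA A.
apply/seteqP; split=> a.
- move=> [Aa|[nAa [B [IB BA nIB]]]]; apply/PKE => //; first exact: sub_VA.
  apply: contrapT => nVa; apply: nIB; apply: proj_indepU1 => //.
  by move=> /(VAS BA).
- move=> /PKE - /(_ subA) VAa; have [Aa|nAa] := pselect (A a); first by left.
  right; split => //; exists (matroid_rank I A).
  have [IR RA _] := matroid_basis_matroid_rank A proj_indep_structure.
  split => // /proj_indepU1N; apply; first by move=> /RA.
  by rewrite VAE (matroid_rank_basis A).2.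
Qed.

Lemma flat_PK A : flat I A <-> exists2 W, subspace W & A = PK W.
Proof.
split=> [<-|[W subW ->]].
  by exists (VA A); [exact: subspace_VA|exact: closure_PK].
by rewrite /flat closure_PK VA_PK.
Qed.

(** The flats are sets [PK W] and [PK W'].  The bases [X] and [Y] extend the
    same basis [C] of [W `&` W'], so [X `&` Y] spans [W `&` W']; and
    [X `|` Y] is independent because a vector common to the spans of [X] and
    of [Y `\` X] lies in [W `&` W'], hence is spanned by both [X `&` Y] and
    [Y `\` X], two disjoint parts of [Y]. *)
Lemma proj_modular : modular I.
Proof.
move=> A B /flat_PK[W subW AE] /flat_PK[W' subW' BE].
have VAA : VA A = W by rewrite AE VA_PK.
have VAB : VA B = W' by rewrite BE VA_PK.
have subI := subspaceI subW subW'.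
have VAI : VA (A `&` B) = W `&` W' by rewrite AE BE -PKI // VA_PK.
have [C [CI CW] _] := lin_basis_extend subI (@lin_indep0 _ _ _) (@sub0set _ _).
have CWW' : C `<=` W `&` W' by rewrite -CW; apply: sub_lin_span.
have [X [XI XW] CX] := lin_basis_extend subW CI (fun v Cv => (CWW' v Cv).1).
have [Y [YI YW] CY] := lin_basis_extend subW' CI (fun v Cv => (CWW' v Cv).2).
have XYspan : lin_span (X `&` Y) = W `&` W'.
  apply/seteqP; split.
    apply: lin_span_min => // v [Xv Yv].
    by split; [rewrite -XW|rewrite -YW]; apply: sub_lin_span.
  by rewrite -CW; apply: lin_spanS => v Cv; split; [apply: CX|apply: CY].
have basisI : lin_basis (VA (A `&` B)) (X `&` Y).
  by rewrite VAI; split => //; apply: lin_indepS XI => v [].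
have basisU : lin_basis (VA (A `|` B)) (X `|` Y).
  split.
    apply: lin_indepU => // w Xw YXw.
    apply: (lin_span_disjoint YI (X := X `&` Y) (Y := Y `\` X)) => //.
    - by move=> v [Xv _] [].
    - rewrite XYspan; split; first by rewrite -XW.
      by rewrite -YW; apply: lin_spanS YXw => v [].
  apply/seteqP; split.
    apply: lin_span_min; first exact: subspace_VA.
    move=> v [Xv|Yv].
    - apply: (@VAS A) => [a Aa|]; first by left.
      by rewrite VAA -XW; apply: sub_lin_span.
    - apply: (@VAS B) => [a Ba|]; first by right.
      by rewrite VAB -YW; apply: sub_lin_span.
  rewrite [X in X `<=` _]VAE; apply: lin_span_min.
    exact: subspace_lin_span.
  move=> _ [a [/sub_VA|/sub_VA] + <-].
  - by rewrite VAA -XW; apply: lin_spanS => v ?; left.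
  - by rewrite VAB -YW; apply: lin_spanS => v ?; right.
rewrite (card_eql (card_sum_eq (@matroid_rank_card A X _)
  (@matroid_rank_card B Y _))) ?VAA ?VAB //.
rewrite (card_eqr (card_sum_eq (matroid_rank_card basisU)
  (matroid_rank_card basisI))).
exact: card_sum_setUI.
Qed.

(** Multiplication by the representative of [g] is a [K]-linear automorphism
    of [L], and it sends representatives of [A] to representatives of the
    translate, though not necessarily to the chosen ones. *)
Lemma proj_indep_mul g A : I A -> I [set (g * x)%g | x in A].
Proof.
move=> /proj_indepE AI.
exists (fun b => (repr g * repr (g^-1 * b))%g).
  by move=> b _; rewrite projM !proj_repr mulVKg.
have g0 : rep g != 0 := valP (repr g).
move=> s c us sA s0 v vs.
have repE w : w \in s -> (rep @` A) ((rep g)^-1 * w).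
  move=> /sA[_ [a Aa <-] <-]; exists a => //=.
  by rewrite mulKg mulKf.
have := AI [seq (rep g)^-1 * w | w <- s] (fun w => c (rep g * w)).
move=> /(_ _ _ _ ((rep g)^-1 * v)); rewrite mulVKf //; apply.
- by rewrite map_inj_uniq //; apply: mulfI; rewrite invr_neq0.
- by move=> _ /= /mapP[w /repE ? ->].
- transitivity ((rep g)^-1 * lin_comb iota s c); last by rewrite s0 mulr0.
  rewrite /lin_comb big_map mulr_sumr.
  by apply: eq_bigr => w _; rewrite mulVKf // mulrCA.
- exact: map_f.
Qed.

Lemma proj_modular_abelian : modular_abelian_independence_group I.
Proof.
split; [split|exact: proj_modular|].
- exact: proj_indep_structure.
- move=> g A; split; last exact: proj_indep_mul.
  move=> /(proj_indep_mul g^-1%g); rewrite image_comp.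
  rewrite (@eq_imagel _ _ _ _ id) ?image_id // => x _; exact: mulKg.
- move=> a b; rewrite -(proj_repr a) -(proj_repr b) -!projM.
  by congr proj; apply: val_inj; apply: mulrC.
Qed.

End ProjectiveMatroid.

Theorem proposition5p8 (K L : fieldType) (iota : {rmorphism K -> L})
    (proper : range iota <> [set: L]) :
  [/\ independence_structure (proj_indep iota),
      modular_abelian_independence_group (proj_indep iota),
      forall A : set (projgroup iota),
        matroid_closure (proj_indep iota) A = PK iota (VA iota A),
      forall A : set (projgroup iota),
        matroid_rank (proj_indep iota) A #= lin_dim iota (VA iota A) &
      forall A : set (projgroup iota),
        flat (proj_indep iota) A <->
        exists2 W : set L, subspace iota W & A = PK iota W].
Proof.
split.
- exact: proj_indep_structure.
- exact: proj_modular_abelian.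
- exact: closure_PK.
- by move=> A; apply/matroid_rank_card/lin_basis_lin_dim/subspace_VA.
- exact: flat_PK.
Qed.
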